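(* Let $r\ge 3$, let $\Delta$ be the root system of type $D_r$ (for $r=3$, $D_3\simeq A_3$), realized in $V=\mathbb{R}^r$ (standard inner product, orthonormal basis $e_1,\dots,e_r$) by $\Delta_+^\vee=\{e_i\pm e_j\mid 1\le i<j\le r\}$ and $\Psi^\vee=\{\alpha_1^\vee=e_1-e_2,\dots,\alpha_{r-1}^\vee=e_{r-1}-e_r,\ \alpha_r^\vee=e_{r-1}+e_r\}$, and let $I=\{2,\dots,r\}$, so that $\Delta^{*\vee}=\{e_1\pm e_j\mid 2\le j\le r\}$. For $2\le i\le r$ write $t_{\pm i}$ for the variable $t_\alpha$ with $\alpha^\vee=e_1\pm e_i$. Let $\mathbf{y}=y_1\alpha_1^\vee+\cdots+y_r\alpha_r^\vee$ with $y_j\in\mathbb{R}$, and $\lambda=m_2\lambda_2+\cdots+m_r\lambda_r\in P_I$ with $m_i\in\mathbb{Z}$. Put $m_{j,k}=m_j+\cdots+m_k$ if $j\le k$ and $m_{j,k}=0$ otherwise. Then the generating function $F(\mathbf{t}_I,\mathbf{y},\lambda;I;\Delta)$ equals, as a meromorphic function of $(t_{\pm i})_{2\le i\le r}$, \begin{align*} &\sum_{j=2}^{r-1}\ \prod_{2\le i<j}\frac{t_{-i}}{t_{-i}-t_{-j}+2\pi\sqrt{-1}\,m_{i,j-1}}\prod_{j<i\le r}\frac{t_{-i}}{t_{-i}-t_{-j}-2\pi\sqrt{-1}\,m_{j,i-1}}\\ &\quad\times\prod_{2\le i\le j}\frac{t_{+i}}{t_{+i}-t_{-j}-2\pi\sqrt{-1}(m_{i,j-1}+2m_{j,r-2}+m_{r-1,r})}\\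 &\quad\times\prod_{j<i<r}\frac{t_{+i}}{t_{+i}-t_{-j}-2\pi\sqrt{-1}(m_{j,i-1}+2m_{i,r-2}+m_{r-1,r})}\\ &\quad\times\frac{t_{+r}}{t_{+r}-t_{-j}-2\pi\sqrt{-1}(m_{j,r-2}+m_r)}\\ &\quad\times\exp\Bigl(2\pi\sqrt{-1}\Bigl(\sum_{i=2}^{j-1}m_i(y_i-y_1)+\sum_{i=j}^{r}m_iy_i\Bigr)\Bigr)\frac{t_{-j}\exp(t_{-j}\{y_1\})}{e^{t_{-j}}-1}\\ &+\prod_{2\le i<r}\frac{t_{-i}}{t_{-i}-t_{-r}+2\pi\sqrt{-1}\,m_{i,r-1}}\prod_{2\le i<r}\frac{t_{+i}}{t_{+i}-t_{-r}-2\pi\sqrt{-1}(m_{i,r-2}+m_r)}\\ &\quad\times\frac{t_{+r}}{t_{+r}-t_{-r}-2\pi\sqrt{-1}(m_r-m_{r-1})}\\ &\quad\times\exp\Bigl(2\pi\sqrt{-1}\Bigl(\sum_{i=2}^{r-1}m_i(y_i-y_1)+m_ry_r\Bigr)\Bigr)\frac{t_{-r}\exp(t_{-r}\{y_1\})}{e^{t_{-r}}-1}\\ &+\sum_{j=2}^{r-1}\ \prod_{2\le i\le j}\frac{t_{-i}}{t_{-i}-t_{+j}+2\pi\sqrt{-1}(m_{i,j-1}+2m_{j,r-2}+m_{r-1,r})}\\ &\quad\times\prod_{j<i<r}\frac{t_{-i}}{t_{-i}-t_{+j}+2\pi\sqrt{-1}(m_{j,i-1}+2m_{i,r-2}+m_{r-1,r})}\\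 &\quad\times\frac{t_{-r}}{t_{-r}-t_{+j}+2\pi\sqrt{-1}(m_{j,r-2}+m_r)}\\ &\quad\times\prod_{2\le i<j}\frac{t_{+i}}{t_{+i}-t_{+j}-2\pi\sqrt{-1}\,m_{i,j-1}}\prod_{j<i\le r}\frac{t_{+i}}{t_{+i}-t_{+j}+2\pi\sqrt{-1}\,m_{j,i-1}}\\ &\quad\times\exp\Bigl(2\pi\sqrt{-1}\Bigl(\sum_{i=2}^{j-1}m_i(y_i-y_1)+\sum_{i=j}^{r-2}m_i(y_i-2y_1)+m_{r-1}(y_{r-1}-y_1)+m_r(y_r-y_1)\Bigr)\Bigr)\\ &\quad\times\frac{t_{+j}\exp(t_{+j}\{y_1\})}{e^{t_{+j}}-1}\\ &+\prod_{2\le i<r}\frac{t_{-i}}{t_{-i}-t_{+r}+2\pi\sqrt{-1}(m_{i,r-2}+m_r)}\cdot\frac{t_{-r}}{t_{-r}-t_{+r}-2\pi\sqrt{-1}(m_{r-1}-m_r)}\\ &\quad\times\prod_{2\le i<r}\frac{t_{+i}}{t_{+i}-t_{+r}-2\pi\sqrt{-1}\,m_{i,r-1}}\\ &\quad\times\exp\Bigl(2\pi\sqrt{-1}\Bigl(\sum_{i=2}^{r-2}m_i(y_i-y_1)+m_{r-1}y_{r-1}+m_r(y_r-y_1)\Bigr)\Bigr)\frac{t_{+r}\exp(t_{+r}\{y_1\})}{e^{t_{+r}}-1}, \end{align*} where $\{\cdot\}$ denotes the fractional part of a real number.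
   Context: Let $\Delta$ be a reduced root system of rank $r$ in a real inner product space $V$ with fundamental system $\Psi=\{\alpha_1,\dots,\alpha_r\}$, positive roots $\Delta_+$, coroots $\alpha^\vee$, coroot lattice $Q^\vee=\bigoplus_i\mathbb{Z}\alpha_i^\vee$, and fundamental weights $\lambda_j$ defined by $\langle\alpha_i^\vee,\lambda_j\rangle=\delta_{ij}$. For a set $A$ of roots, $A^\vee$ is the set of corresponding coroots. For $I\subset\{1,\dots,r\}$ put $\Psi_I=\{\alpha_i\mid i\in I\}$, $\Delta_I=\Delta\cap\mathrm{span}(\Psi_I)$, $\Delta_{I+}=\Delta_I\cap\Delta_+$, $P_I=\bigoplus_{i\in I}\mathbb{Z}\lambda_i$, $\Delta^*=\Delta_+\setminus\Delta_{I+}$, $d=|I^c|$. Let $\mathscr{V}_I$ be the set of all bases of $V$ of the form $\mathbf{V}=\mathbf{V}_I\cup\Psi_I$ with $\mathbf{V}_I\subset\Delta^*$, $|\mathbf{V}_I|=d$. For $\mathbf{V}\in\mathscr{V}_I$ let $L(\mathbf{V}^\vee)=\bigoplus_{\beta\in\mathbf{V}}\mathbb{Z}\beta^\vee\subset Q^\vee$, let $\{\mu^{\mathbf{V}}_\gamma\}_{\gamma\in\mathbf{V}}$ be the basis of $V$ dual to $\mathbf{V}^\vee$, and put $$p_{\mathbf{V}_I^\perp}(v)=v-\sum_{\gamma\in\mathbf{V}_I}\mu^{\mathbf{V}}_\gamma\langle\gamma^\vee,v\rangle\qquad(v\in V).$$ Fix $\phi\in V$ not lying in any hyperplane spanned by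 $r-1$ linearly independent coroots; in the present setting $\phi$ is chosen with $\langle\phi,\lambda_1\rangle>0$. For $\mathbf{y}\in V$, $\beta\in\mathbf{V}$, set $\{\mathbf{y}\}_{\mathbf{V},\beta}=\{\langle\mathbf{y},\mu^{\mathbf{V}}_\beta\rangle\}$ if $\langle\phi,\mu^{\mathbf{V}}_\beta\rangle>0$ and $\{\mathbf{y}\}_{\mathbf{V},\beta}=1-\{-\langle\mathbf{y},\mu^{\mathbf{V}}_\beta\rangle\}$ if $\langle\phi,\mu^{\mathbf{V}}_\beta\rangle<0$, where $\{\cdot\}$ on the right is the usual fractional part. For $\mathbf{t}_I=(t_\alpha)_{\alpha\in\Delta^*}$ complex variables and $\lambda\in P_I$ the generating function is \begin{align*} F(\mathbf{t}_I,\mathbf{y},\lambda;I;\Delta)=\sum_{\mathbf{V}\in\mathscr{V}_I}&\Bigl(\prod_{\gamma\in\Delta^*\setminus\mathbf{V}_I}\frac{t_\gamma}{t_\gamma-\sum_{\beta\in\mathbf{V}_I}t_\beta\langle\gamma^\vee,\mu^{\mathbf{V}}_\beta\rangle-2\pi\sqrt{-1}\langle\gamma^\vee,p_{\mathbf{V}_I^\perp}(\lambda)\rangle}\Bigr)\\ &\times\frac{1}{|Q^\vee/L(\mathbf{V}^\vee)|}\sum_{q\in Q^\vee/L(\mathbf{V}^\vee)}\exp\bigl(2\pi\sqrt{-1}\langle\mathbf{y}+q,p_{\mathbf{V}_I^\perp}(\lambda)\rangle\bigr)\prod_{\beta\in\mathbf{V}_I}\frac{t_\beta\exp(t_\beta\{\mathbf{y}+q\}_{\mathbf{V},\beta})}{e^{t_\beta}-1}.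 \end{align*} Empty sums are $0$ and empty products are $1$. *)

(* Defs.v *)
From HB Require Import structures.
From mathcomp Require Import all_boot all_order all_algebra.
From mathcomp Require Import finmap complex.
From mathcomp Require Import boolp classical_sets cardinality reals sequences trigo.

Set Implicit Arguments.
Unset Strict Implicit.
Unset Printing Implicit Defensive.

Import Order.TTheory GRing.Theory Num.Theory.
Local Open Scope ring_scope.
Local Open Scope complex_scope.

Definition cexp (R : realType) (z : R[i]) : R[i] :=
  let: a +i* b := z in (expR a * cos b) +i* (expR a * sin b).

Definition twopii (R : realType) : R[i] := 0 +i* (2 * pi).

Definition fracR (R : realType) (x : R) : R := x - (Num.floor x)%:~R.

Section InnerProduct.
Context {R : realType} {n : nat}.
Implicit Types u v : 'rV[R]_n.

Definition dot u v : R := \sum_(i < n) u 0 i * v 0 i.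

Definition coroot u : 'rV[R]_n := (2 / dot u u) *: u.

Definition coroots (A : {fset 'rV[R]_n}) : seq 'rV[R]_n :=
  [seq coroot a | a <- A].

End InnerProduct.

(* The ambient space V is R^n with its standard inner product, n being the    *)
(* rank.  A root system is given by its positive roots and its fundamental    *)
(* system; the latter determines which roots are positive by the last axiom.  *)
(* The ordinal i : 'I_n stands for the index i + 1 of {1, ..., n}.            *)
Record rootSystem (R : realType) (n : nat) := RootSystem {
  posRoots : {fset 'rV[R]_n};
  simpleRoot : 'I_n -> 'rV[R]_n;
  allRoots := (posRoots `|` [fset - a | a in posRoots])%fset;
  roots_neq0 : 0 \notin allRoots;
  roots_refl : forall a b, a \in allRoots -> b \in allRoots ->
    b - dot (coroot a) b *: a \in allRoots;
  roots_int : forall a b, a \in allRoots -> b \in allRoots ->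
    dot (coroot a) b \is a Num.int;
  roots_reduced : forall (c : R) a, a \in allRoots -> c *: a \in allRoots ->
    c = 1 \/ c = -1;
  simple_pos : forall i, simpleRoot i \in posRoots;
  simple_basis : basis_of fullv [seq simpleRoot i | i : 'I_n];
  posRoots_nneg : forall a, a \in posRoots ->
    exists c : 'I_n -> nat, a = \sum_(i < n) simpleRoot i *+ c i
}.

Section GeneratingFunction.
Context {R : realType} {n : nat}.
Implicit Types (D : rootSystem R n) (A B : {fset 'rV[R]_n}) (I : {set 'I_n}).
Implicit Types (v y phi : 'rV[R]_n).

Definition simpleRoots D : {fset 'rV[R]_n} :=
  [fset simpleRoot D i | i in 'I_n]%fset.

(* For a basis B of V and g \in B, the vector mu_g^B of the basis dual to     *)
(* B^vee; the pairing conditions determine it uniquely.                       *)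
Definition dualVec B (g : 'rV[R]_n) : 'rV[R]_n :=
  xget 0 [set mu | forall b, b \in B -> dot (coroot b) mu = (b == g)%:R]%classic.

Definition fundWeight D (j : 'I_n) : 'rV[R]_n :=
  dualVec (simpleRoots D) (simpleRoot D j).

(* L(B^vee), the Z-span of the coroots of B. *)
Definition corootLattice B : set 'rV[R]_n :=
  [set v | exists c : 'rV[R]_n -> int,
     v = \sum_(b <- B) coroot b *~ c b]%classic.

(* The cosets of L(B^vee) in Q^vee. *)
Definition latticeQuotient D B : {fset set 'rV[R]_n} :=
  fset_set [set [set q + l | l in corootLattice B]
              | q in corootLattice (simpleRoots D)]%classic.

Definition simpleSub D I : {fset 'rV[R]_n} :=
  [fset simpleRoot D i | i in I]%fset.

Definition posRootsSub D I : {fset 'rV[R]_n} :=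
  [fset a in posRoots D | a \in <<simpleSub D I>>%VS]%fset.

(* Delta^* *)
Definition posRootsStar D I : {fset 'rV[R]_n} :=
  (posRoots D `\` posRootsSub D I)%fset.

(* The set of the V_I, for V = V_I \cup Psi_I ranging over script V_I; V_I    *)
(* and V determine each other, as V_I is disjoint from Psi_I.                 *)
Definition basesI D I : {fset {fset 'rV[R]_n}} :=
  [fset B in fpowerset (posRootsStar D I) |
     (#|` B| == #|~: I|) && basis_of fullv (B `|` simpleSub D I)%fset]%fset.

(* The projection p along the mu_g, g in B = V_I. *)
Definition perpProj D I B v : 'rV[R]_n :=
  v - \sum_(g <- B) dot (coroot g) v *: dualVec (B `|` simpleSub D I)%fset g.

Definition genericVec D phi : Prop :=
  forall A, (A `<=` allRoots D)%fset -> #|` A| = n.-1 -> free (coroots A) ->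
    phi \notin <<coroots A>>%VS.

(* {y}_{V,b}; for a generic phi the scalar product with mu is never 0. *)
Definition fracPart phi y B (b : 'rV[R]_n) : R :=
  let mu := dualVec B b in
  if 0 < dot phi mu then fracR (dot y mu) else 1 - fracR (- dot y mu).

(* The denominator attached to V_I = B and g \in Delta^* \ V_I. *)
Definition linDen D I B (t : 'rV[R]_n -> R[i]) (la g : 'rV[R]_n) : R[i] :=
  t g - \sum_(b <- B)
          t b * (dot (coroot g) (dualVec (B `|` simpleSub D I)%fset b))%:C
      - twopii R * (dot (coroot g) (perpProj D I B la))%:C.

(* The variables t_a, for a \in Delta^*, are given by a function t on V, of   *)
(* which only the values on Delta^* are used.                                 *)
Definition genFun D I phi (t : 'rV[R]_n -> R[i]) y (la : 'rV[R]_n) : R[i] :=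
  \sum_(B <- basesI D I)
    let V := (B `|` simpleSub D I)%fset in
    let Q := latticeQuotient D V in
    (\prod_(g <- (posRootsStar D I `\` B)%fset) (t g / linDen D I B t la g)) *
    ((#|` Q|)%:R^-1 *
     \sum_(q <- Q)
       let yq := y + xget 0 q in
       cexp (twopii R * (dot yq (perpProj D I B la))%:C) *
       \prod_(b <- B)
         (t b * cexp (t b * (fracPart phi yq V b)%:C) / (cexp (t b) - 1))).

(* The complement of the zero loci of the denominators of genFun: an          *)
(* identity of meromorphic functions of t is an identity at these t.          *)
Definition offPoles D I (t : 'rV[R]_n -> R[i]) (la : 'rV[R]_n) : Prop :=
  forall B, B \in basesI D I ->
    (forall g, g \in (posRootsStar D I `\` B)%fset -> linDen D I B t la g != 0)
    /\ (forall b, b \in B -> cexp (t b) != 1).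

End GeneratingFunction.

(* e_1, ..., e_r *)
Definition evec (R : realType) (r k : nat) : 'rV[R]_r :=
  \row_(j < r) (j.+1 == k)%:R.

Section TypeD.
Variables (R : realType) (r : nat).
Local Notation e := (evec R r).

Definition posRootsD : {fset 'rV[R]_r} :=
  ([fset (e i - e j)%R | i in iota 1 r, j in iota i.+1 (r - i)] `|`
   [fset (e i + e j)%R | i in iota 1 r, j in iota i.+1 (r - i)])%fset.

Definition simpleD (i : 'I_r) : 'rV[R]_r :=
  if i.+1 == r then e r.-1 + e r else e i.+1 - e i.+2.

Local Notation rootsD := (posRootsD `|` [fset - a | a in posRootsD])%fset.

Lemma posRootsDP v : reflect
  (exists i j, [/\ (0 < i)%N, (i < j)%N, (j <= r)%N &
      v = e i - e j \/ v = e i + e j])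
  (v \in posRootsD).
Proof.
have it i j : (i \in iota 1 r) && (j \in iota i.+1 (r - i)) =
    [&& (0 < i)%N, (i < j)%N & (j <= r)%N].
  rewrite !mem_iota add1n ltnS.
  case: (leqP i r) => ir; first by rewrite addSn subnKC // ltnS; case: (0 < i)%N.
  by rewrite andbF /=; apply/esym/and3P => -[_ h1 h2]; move: ir;
    rewrite ltnNge (leq_trans (ltnW h1) h2).
rewrite in_fsetU; apply: (iffP orP).
  case=> /imfset2P[i /= hi [j /= hj ->]]; exists i, j;
    have /and3P[? ? ?] : [&& (0 < i)%N, (i < j)%N & (j <= r)%N]
      by rewrite -it hi hj.
  - by split=> //; left.
  - by split=> //; right.
case=> i [j [h0 hij hj H]].
have /andP[hi' hj'] : (i \in iota 1 r) && (j \in iota i.+1 (r - i)).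
  by rewrite it h0 hij hj.
by case: H => ->; [left|right]; apply/imfset2P; exists i => //; exists j.
Qed.

Lemma rootsDP v : reflect
  (exists i j (s t : bool), [/\ (0 < i <= r)%N, (0 < j <= r)%N, i != j &
      v = (-1) ^+ s *: e i + (-1) ^+ t *: e j])
  (v \in rootsD).
Proof.
rewrite in_fsetU; apply: (iffP orP).
- case.
  + move=> /posRootsDP[i [j [h0 hij hj H]]].
    have hi : (0 < i <= r)%N by rewrite h0 (leq_trans (ltnW hij)).
    have hj' : (0 < j <= r)%N by rewrite hj (leq_ltn_trans _ hij).
    have hne : i != j by rewrite neq_ltn hij.
    case: H => ->; [exists i, j, false, true|exists i, j, false, false];
      by split=> //; rewrite ?expr0 ?expr1 ?scaleN1r ?scale1r.
  + case/imfsetP => w /= /posRootsDP[i [j [h0 hij hj H]]] ->.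
    have hi : (0 < i <= r)%N by rewrite h0 (leq_trans (ltnW hij)).
    have hj' : (0 < j <= r)%N by rewrite hj (leq_ltn_trans _ hij).
    have hne : i != j by rewrite neq_ltn hij.
    case: H => ->; [exists i, j, true, false|exists i, j, true, true];
      by split=> //; rewrite ?expr0 ?expr1 ?scaleN1r ?scale1r opprD ?opprK.
- case=> i [j [s [t [hi hj hij ->]]]].
  wlog ltij : i j s t hi hj hij / (i < j)%N.
    move=> W; case: (ltngtP i j) hij => // [lt _|gt _].
      by apply: W => //; rewrite neq_ltn lt.
    by rewrite addrC; apply: W => //; rewrite neq_ltn gt.
  case/andP: hi => hi _; case/andP: hj => _ hj.
  case: s; case: t; rewrite ?expr0 ?expr1 ?scaleN1r ?scale1r.
  + right; apply/imfsetP; exists (e i + e j) => /=; last by rewrite opprD.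
    by apply/posRootsDP; exists i, j; split=> //; right.
  + right; apply/imfsetP; exists (e i - e j) => /=; last by rewrite opprB addrC.
    by apply/posRootsDP; exists i, j; split=> //; left.
  + by left; apply/posRootsDP; exists i, j; split=> //; left.
  + by left; apply/posRootsDP; exists i, j; split=> //; right.
Qed.

Lemma dotDl (u v w : 'rV[R]_r) : dot (u + v) w = dot u w + dot v w.
Proof. by rewrite -big_split; apply: eq_bigr => i _; rewrite mxE mulrDl. Qed.

Lemma dotDr (u v w : 'rV[R]_r) : dot w (u + v) = dot w u + dot w v.
Proof. by rewrite -big_split; apply: eq_bigr => i _; rewrite mxE mulrDr. Qed.

Lemma dotZl c (u w : 'rV[R]_r) : dot (c *: u) w = c * dot u w.
Proof. by rewrite mulr_sumr; apply: eq_bigr => i _; rewrite mxE mulrA. Qed.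

Lemma dotZr c (u w : 'rV[R]_r) : dot w (c *: u) = c * dot w u.
Proof. by rewrite mulr_sumr; apply: eq_bigr => i _; rewrite mxE mulrCA. Qed.

Lemma dot_evec i j : (0 < i <= r)%N -> dot (e i) (e j) = (i == j)%:R.
Proof.
case: i => // i /= hi; rewrite /dot (bigD1 (Ordinal hi)) //= !mxE eqxx mul1r.
rewrite big1 ?addr0 // => k; rewrite -val_eqE /= => /negbTE hk.
by rewrite mxE eqSS hk mul0r.
Qed.

Lemma sqr_signr (s : bool) : (-1) ^+ s * (-1) ^+ s = 1 :> R.
Proof. by rewrite -signr_addb addbb. Qed.

Lemma dot_rootsD v : v \in rootsD -> dot v v = 2.
Proof.
case/rootsDP=> i [j [s [t [hi hj /negbTE hij ->]]]].
rewrite !(dotDl, dotDr, dotZl, dotZr) !dot_evec // !eqxx hij eq_sym hij.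
by rewrite !mulr0 !mulr1 addr0 add0r !sqr_signr.
Qed.

(* Roots and coroots of D_r coincide in this realization. *)
Lemma coroot_rootsD v : v \in rootsD -> coroot v = v.
Proof.
by move=> hv; rewrite /coroot dot_rootsD // divff ?pnatr_eq0 // scale1r.
Qed.

Lemma rootsD_neq0 : 0 \notin rootsD.
Proof.
apply/negP => /dot_rootsD /eqP; rewrite /dot big1 => [|i _].
  by rewrite eq_sym pnatr_eq0.
by rewrite mxE mul0r.
Qed.

Lemma rootsD_opp v : v \in rootsD -> - v \in rootsD.
Proof.
case/rootsDP=> i [j [s [t [hi hj hij ->]]]]; apply/rootsDP.
by exists i, j, (~~ s), (~~ t); split=> //; rewrite !signrN !scaleNr opprD.
Qed.

Lemma rootsD_int a b : a \in rootsD -> b \in rootsD ->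
  dot (coroot a) b \is a Num.int.
Proof.
move=> ha; rewrite coroot_rootsD //; case/rootsDP: ha => i [j [s [t [hi hj _ ->]]]].
case/rootsDP=> k [l [s' [t' [_ _ _ ->]]]].
rewrite !(dotDl, dotDr, dotZl, dotZr) !dot_evec //.
by rewrite !(rpredD, rpredM) // ?rpred_nat // rpred_sign.
Qed.

Lemma rootsD_refl a b : a \in rootsD -> b \in rootsD ->
  b - dot (coroot a) b *: a \in rootsD.
Proof.
move=> ha hb; rewrite coroot_rootsD //.
case/rootsDP: (ha) => i [j [s [t [hi hj hij Ea]]]].
case/rootsDP: (hb) => k [l [s' [t' [hk hl hkl Eb]]]].
have EE : dot a b = (-1) ^+ s * ((-1) ^+ s' * (i == k)%:R)
     + (-1) ^+ s * ((-1) ^+ t' * (i == l)%:R)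
     + ((-1) ^+ t * ((-1) ^+ s' * (j == k)%:R)
     + (-1) ^+ t * ((-1) ^+ t' * (j == l)%:R)).
  by rewrite Ea Eb !(dotDl, dotDr, dotZl, dotZr) !dot_evec // !mulrDr.
have [H|H] := boolP [|| i == k, i == l, j == k | j == l]; last first.
  move: H; rewrite !negb_or => /and4P[/negbTE h1 /negbTE h2 /negbTE h3 /negbTE h4].
  by rewrite EE h1 h2 h3 h4 !mulr0 !addr0 scale0r subr0.
wlog ik : i j k l s t s' t' hi hj hk hl hij hkl Ea Eb EE H / i = k.
  move=> W; case/or4P: (H) => /eqP h.
  - exact: (W i j k l s t s' t').
  - apply: (W i j l k s t t' s') => //; first by rewrite eq_sym.
    + by rewrite Eb addrC.
    + by rewrite EE; congr (_ + _); rewrite addrC.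
    + by move: H; rewrite orbCA; case: (i == k); case: (i == l);
        case: (j == k); case: (j == l).
  - apply: (W j i k l t s s' t') => //; first by rewrite eq_sym.
    + by rewrite Ea addrC.
    + by rewrite EE addrC.
    + by case: (i == k) H; case: (i == l); case: (j == k); case: (j == l).
  - apply: (W j i l k t s t' s') => //; try by rewrite eq_sym.
    + by rewrite Ea addrC.
    + by rewrite Eb addrC.
    + by rewrite EE [RHS]addrC; congr (_ + _); rewrite addrC.
    + by case: (i == k) H; case: (i == l); case: (j == k); case: (j == l).
subst k.
have il : (i == l) = false by apply/negbTE.
have ji : (j == i) = false by rewrite eq_sym; apply/negbTE.
rewrite EE eqxx il ji !mulr0 !mulr1 addr0 add0r.
have [jl|jl] := eqVneq j l; last first.
  rewrite !mulr0 addr0 Eb Ea scalerDr !scalerA.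
  rewrite [(-1) ^+ s * _ * (-1) ^+ s]mulrAC sqr_signr mul1r opprD.
  rewrite addrACA subrr add0r -!signr_addb -scaleNr -signrN.
  by apply/rootsDP; exists l, j, t', (~~ (s (+) s' (+) t)); split=> //;
    rewrite eq_sym.
subst l; rewrite mulr1 -!signr_addb.
case st: (s (+) s'); case tt: (t (+) t').
- have -> : b = - a.
    rewrite Eb Ea opprD -!scaleNr -!signrN.
    by congr (_ *: _ + _ *: _); congr (_ ^+ nat_of_bool _);
      [case: (s) st | case: (t) tt]; case: (s') => //; case: (t') => //;
      case: (s') => //.
  by rewrite expr1 scalerDl scaleN1r opprD opprK addrA addNr add0r.
- by rewrite expr1 expr0 addNr scale0r subr0.
- by rewrite expr1 expr0 addrN scale0r subr0.
- have -> : b = a.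
    rewrite Eb Ea.
    have -> : s' = s by case: (s) st; case: (s').
    by have -> : t' = t by case: (t) tt; case: (t').
  by rewrite expr0 scalerDl scale1r opprD addrA subrr add0r rootsD_opp.
Qed.

Lemma rootsD_reduced (c : R) a : a \in rootsD -> c *: a \in rootsD ->
  c = 1 \/ c = -1.
Proof.
move=> ha /dot_rootsD; rewrite dotZl dotZr dot_rootsD // mulrA => /eqP.
rewrite -subr_eq0 -[X in _ - X]mul1r -mulrBl mulf_eq0 pnatr_eq0 orbF subr_eq0.
by rewrite -expr2 sqrf_eq1 => /orP[]/eqP; [left|right].
Qed.

Hypothesis hr : (3 <= r)%N.

Lemma simpleD_last : exists i, simpleD i = e r.-1 + e r.
Proof.
have h : (r.-1 < r)%N by rewrite prednK // (leq_trans _ hr).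
by exists (Ordinal h); rewrite /simpleD /= prednK ?eqxx // (leq_trans _ hr).
Qed.

Lemma simpleD_step k : (0 < k < r)%N -> exists i, simpleD i = e k - e k.+1.
Proof.
case: k => // k /= hk; exists (Ordinal (ltnW hk)).
by rewrite /simpleD /= (ltn_eqF hk).
Qed.

Lemma simpleD_pos i : simpleD i \in posRootsD.
Proof.
have r0 : (0 < r)%N by rewrite (leq_trans _ hr).
apply/posRootsDP; rewrite /simpleD; case: ifPn => h.
  exists r.-1, r; split=> //; last by right.
  - by rewrite -subn1 subn_gt0 (leq_trans _ hr).
  - by rewrite prednK.
exists i.+1, i.+2; split=> //; last by left.
by rewrite ltn_neqAle h ltn_ord.
Qed.

Lemma simpleD_basis : basis_of fullv [seq simpleD i | i : 'I_r].
Proof.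
rewrite basisEdim size_map -cardE card_ord dimvf /dim /= mul1n leqnn andbT.
set S := <<_>>%VS.
have r0 : (0 < r)%N by rewrite (leq_trans _ hr).
have hS i : simpleD i \in S by apply/memv_span/map_f; rewrite mem_enum.
have hl : e r.-1 + e r \in S by have [i <-] := simpleD_last.
have hs k : (0 < k < r)%N -> e k - e k.+1 \in S.
  by move=> /simpleD_step[i <-].
have her : e r \in S.
  have h : e r.-1 - e r \in S.
    have := hs r.-1; rewrite prednK // leqnn andbT; apply.
    by rewrite -subn1 subn_gt0 (leq_trans _ hr).
  have -> : e r = 2^-1 *: ((e r.-1 + e r) - (e r.-1 - e r)).
    rewrite opprB addrC addrA subrK -mulr2n -scaler_nat scalerA.
    by rewrite mulVf ?scale1r // pnatr_eq0.
  by rewrite rpredZ // rpredB.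
have he d : (d < r)%N -> e (r - d) \in S.
  elim: d => [|d IH] hd; first by rewrite subn0.
  rewrite -(subrK (e (r - d)) (e (r - d.+1))) rpredD // ?IH ?(ltnW hd) //.
  rewrite -(subnSK (ltnW hd)); apply: hs; rewrite subn_gt0 hd /=.
  by rewrite -subn_gt0 subKn // ltnW.
apply/subvP => v _; rewrite (row_sum_delta v) rpred_sum // => i _.
rewrite rpredZ //; suff -> : delta_mx 0 i = e (r - (r - i.+1)).
  by apply: he; rewrite -subn_gt0 subKn.
by rewrite subKn //; apply/rowP=> j; rewrite !mxE eqxx eqSS.
Qed.

Lemma posRootsD_nneg a : a \in posRootsD ->
  exists c : 'I_r -> nat, a = \sum_(i < r) simpleD i *+ c i.
Proof.
have r0 : (0 < r)%N by rewrite (leq_trans _ hr).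
set P := fun a => exists c : 'I_r -> nat, a = \sum_(i < r) simpleD i *+ c i.
have PD u v : P u -> P v -> P (u + v).
  move=> [c ->] [d ->]; exists (fun i => c i + d i)%N.
  by rewrite -big_split; apply: eq_bigr => i _; rewrite mulrnDr.
have PS i : P (simpleD i).
  exists (fun k => k == i : nat); rewrite (bigD1 i) //= eqxx mulr1n.
  by rewrite big1 ?addr0 // => k /negbTE ->; rewrite mulr0n.
have Pm i d : (0 < i)%N -> (i + d.+1 <= r)%N -> P (e i - e (i + d.+1)%N).
  move=> i0; elim: d => [|d IH] hd.
    by rewrite addn1; have [|k <-] := @simpleD_step i; rewrite // i0 -addn1.
  rewrite -(subrK (e (i + d.+1)%N) (e i)) -addrA; apply: PD.
    by apply: IH; rewrite (leq_trans _ hd) // leq_add2l.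
  rewrite (addnS i d.+1); have [|k <-] := @simpleD_step (i + d.+1); last exact: PS.
  by rewrite addn_gt0 i0 -addnS.
have {}Pm i j : (0 < i)%N -> (i < j)%N -> (j <= r)%N -> P (e i - e j).
  move=> i0 ij jr; have := @Pm i (j - i).-1 i0.
  by rewrite prednK ?subn_gt0 // subnKC ?(ltnW ij) //; apply.
have Pl : P (e r.-1 + e r) by have [i <-] := simpleD_last.
have Pr i : (0 < i)%N -> (i < r)%N -> P (e i + e r).
  move=> i0 ir; have : (i <= r.-1)%N by rewrite -ltnS prednK.
  rewrite leq_eqVlt => /orP[/eqP-> //|h].
  rewrite -(subrK (e r.-1) (e i)) -addrA; apply: PD => //.
  by apply: Pm => //; rewrite leq_pred.
case/posRootsDP=> i [j [i0 ij jr [->|->]]]; first exact: Pm.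
move: jr; rewrite leq_eqVlt => /orP[/eqP jr|jr].
  by rewrite jr in ij *; apply: Pr.
rewrite -(subrK (e r) (e i)) -addrA [e r + _]addrC; apply: PD.
  by apply: Pm => //; rewrite (ltn_trans ij jr).
by apply: Pr => //; rewrite (ltn_trans i0 ij).
Qed.

Definition rootSystemD : rootSystem R r :=
  @RootSystem R r posRootsD simpleD rootsD_neq0 rootsD_refl rootsD_int
    rootsD_reduced simpleD_pos simpleD_basis posRootsD_nneg.

End TypeD.

(* Main.v *)
Require Import Defs.
From HB Require Import structures.
From mathcomp Require Import all_boot all_order all_algebra.
From mathcomp Require Import finmap complex.
From mathcomp Require Import boolp classical_sets cardinality reals sequences trigo.
From mathcomp Require Import ring zify.

Import Order.TTheory GRing.Theory Num.Theory.
Local Open Scope ring_scope.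
Local Open Scope complex_scope.

(**
The set Delta^* consists of the roots b = e_1 +- e_j, and Psi_I spans the
hyperplane orthogonal to e_1. So every V in script V_I is {b} together with
Psi_I for a single b in Delta^*, and since <b, e_1> = 1, the dual vector mu_b
is always e_1 (dualVec_V). Each positive root in Delta^* contains the simple
root alpha_1 with coefficient 1, so V generates the whole coroot lattice and
the average over Q^vee / L(V^vee) has one term (lattice_V, latticeQuotient1).
Which representative q is chosen there does not matter, because <q, e_1> and
<q, p(lambda)> are integers while the fractional part and z |-> exp(2 pi i z)
have period 1. As phi pairs positively with lambda_1 = e_1, the fractional part
is {y_1} for every b. This gives genFunD, the generating function as a sum over
b in Delta^* of

  prod_(g <> b) t_g / (t_g - t_b - 2 pi i <g - b, lambda>)
    * exp (2 pi i (<y, lambda> - <b, lambda> y_1))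
    * t_b exp (t_b {y_1}) / (exp t_b - 1).

It remains to express the pairings by the m_i. With a_k = <e_k, lambda> the
conditions <alpha_i^vee, lambda> = m_i become a_k - a_(k+1) = m_k for
2 <= k < r, a_(r-1) + a_r = m_r and a_1 = a_2. Hence
m_{i,j-1} = a_i - a_j, and m_{j,r-2} = a_j - a_(r-1), and
m_{r-1,r} = 2 a_(r-1); every denominator of the formula is
t_g - t_b - 2 pi i (+- a_i +- a_j), and the exponents are obtained by
collecting the coefficient of y_1, which is -<b, lambda> = - (a_2 +- a_j).
The terms with j = r are separate because m_{j,r-2} = a_j - a_(r-1) needs
j < r.
*)

Local Arguments cexp : simpl never.
Local Arguments twopii : simpl never.

(** * The scalar product and dual bases *)

Section Pairing.
Context {R : realType} {n : nat}.
Implicit Types (u v w mu : 'rV[R]_n) (B : {fset 'rV[R]_n}).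

Lemma dotC u v : dot u v = dot v u.
Proof. by apply: eq_bigr => i _; rewrite mulrC. Qed.

Lemma dotNl u w : dot (- u) w = - dot u w.
Proof. by rewrite -scaleN1r dotZl mulN1r. Qed.

Lemma dotNr u w : dot w (- u) = - dot w u.
Proof. by rewrite dotC dotNl dotC. Qed.

Lemma dotBl u v w : dot (u - v) w = dot u w - dot v w.
Proof. by rewrite dotDl dotNl. Qed.

Lemma dotBr u v w : dot w (u - v) = dot w u - dot w v.
Proof. by rewrite dotDr dotNr. Qed.

Lemma dot_suml (T : Type) (s : seq T) (P : pred T) (F : T -> 'rV[R]_n) w :
  dot (\sum_(x <- s | P x) F x) w = \sum_(x <- s | P x) dot (F x) w.
Proof.
apply: (big_morph (fun u => dot u w)) => [u v|]; first exact: dotDl.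
by rewrite -(scale0r 0) dotZl mul0r.
Qed.

Lemma dot_sumr (T : Type) (s : seq T) (P : pred T) (F : T -> 'rV[R]_n) w :
  dot w (\sum_(x <- s | P x) F x) = \sum_(x <- s | P x) dot w (F x).
Proof. by rewrite dotC dot_suml; apply: eq_bigr => x _; rewrite dotC. Qed.

Lemma dotMnl u w (k : nat) : dot (u *+ k) w = dot u w *+ k.
Proof. by rewrite -scaler_nat dotZl mulr_natl. Qed.

Lemma dotMzl u w (k : int) : dot (u *~ k) w = dot u w *~ k.
Proof. by rewrite -scaler_int dotZl mulrzl. Qed.

Lemma dotMzr u w (k : int) : dot w (u *~ k) = dot w u *~ k.
Proof. by rewrite dotC dotMzl dotC. Qed.

Lemma dot_span0 (X : seq 'rV[R]_n) w v :
  {in X, forall b, dot b w = 0} -> v \in <<X>>%VS -> dot v w = 0.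
Proof.
move=> Xw vX; rewrite (coord_span (X := in_tuple X) vX) dot_suml big1 // => i _.
by rewrite dotZl Xw ?mulr0 // mem_nth.
Qed.

(** Makes dual vectors unique. *)
Lemma dot_fullv_inj (X : seq 'rV[R]_n) mu w :
  <<X>>%VS = fullv -> {in X, forall b, dot b mu = dot b w} -> mu = w.
Proof.
move=> Xfull Xmu; apply/eqP; rewrite -subr_eq0; apply/eqP/rowP => i.
rewrite mxE; have : dot (delta_mx 0 i) (mu - w) = 0.
  apply: (@dot_span0 X) => [b bX|]; last by rewrite Xfull memvf.
  by rewrite dotBr Xmu ?subrr.
rewrite /dot (bigD1 i) //= big1 => [|j /negbTE ji]; last first.
  by rewrite mxE ji andbF mul0r.
by rewrite !mxE !eqxx mul1r addr0.
Qed.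

(** The Riesz representation of a linear form. *)
Lemma dot_riesz (f : {linear 'rV[R]_n -> R^o}) :
  exists mu, forall v, dot v mu = f v.
Proof.
exists (\row_i f (delta_mx 0 i)) => v.
rewrite {2}(row_sum_delta v) linear_sum; apply: eq_bigr => i _.
by rewrite linearZ mxE.
Qed.

(** The coordinates with respect to the basis B^vee are linear forms, so they
    are pairings with vectors; hence the dual vectors that dualVec selects
    exist. *)
Lemma dualVecP B b g : basis_of fullv (coroots B) -> g \in B -> b \in B ->
  dot (coroot b) (dualVec B g) = (b == g)%:R.
Proof.
move=> /andP[_ freeB] gB bB; rewrite /dualVec.
suff ex_mu : exists mu, forall c, c \in B -> dot (coroot c) mu = (c == g)%:R.
  exact: (xgetPex 0 ex_mu).
have szB : size (coroots B) = size B by rewrite size_map.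
have index_lt c : c \in B -> (index c B < size (coroots B))%N.
  by rewrite szB index_mem.
have [mu mu_coord] :=
  dot_riesz (coord (in_tuple (coroots B)) (Ordinal (index_lt g gB))).
exists mu => c cB; rewrite mu_coord.
have <- : (in_tuple (coroots B))`_(Ordinal (index_lt c cB)) = coroot c.
  by rewrite (nth_map 0) ?index_mem // nth_index.
rewrite [LHS](coord_free (X := in_tuple (coroots B))) // -val_eqE /=.
congr (nat_of_bool _)%:R.
by apply/eqP/eqP => [/(congr1 (nth 0 B))|->//]; rewrite !nth_index.
Qed.

Lemma dualVec_unique B g mu : basis_of fullv (coroots B) -> g \in B ->
  (forall b, b \in B -> dot (coroot b) mu = (b == g)%:R) -> dualVec B g = mu.
Proof.
move=> basisB gB mu_dual; apply: (@dot_fullv_inj (coroots B)).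
  by case/andP: basisB => /eqP.
by move=> _ /mapP[b bB ->]; rewrite dualVecP ?mu_dual.
Qed.

End Pairing.

(** * Coroot lattices *)

Section Lattice.
Context {R : realType} {n : nat}.
Implicit Types (B C : {fset 'rV[R]_n}) (u v w : 'rV[R]_n).

Lemma corootLattice0 B : corootLattice B 0.
Proof. by exists (fun=> 0); rewrite big1 // => b _; rewrite mulr0z. Qed.

Lemma corootLatticeD B u v :
  corootLattice B u -> corootLattice B v -> corootLattice B (u + v).
Proof.
move=> [c ->] [d ->]; exists (fun b => c b + d b).
by rewrite -big_split; apply: eq_bigr => b _; rewrite mulrzDr.
Qed.

Lemma corootLatticeMz B u (k : int) :
  corootLattice B u -> corootLattice B (u *~ k).
Proof.
move=> [c ->]; exists (fun b => c b * k).
by rewrite mulrz_suml; apply: eq_bigr => b _; rewrite mulrzA.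
Qed.

Lemma corootLatticeB B u v :
  corootLattice B u -> corootLattice B v -> corootLattice B (u - v).
Proof.
move=> Bu /(corootLatticeMz _ _ (-1)).
by rewrite mulrN1z; apply: corootLatticeD.
Qed.

Lemma corootLattice_sum (T : eqType) B (s : seq T) (P : pred T) F :
    (forall x, x \in s -> P x -> corootLattice B (F x)) ->
  corootLattice B (\sum_(x <- s | P x) F x).
Proof.
move=> BF; rewrite big_seq_cond; apply: big_ind => [|u v|x /andP[]].
- exact: corootLattice0.
- exact: corootLatticeD.
- exact: BF.
Qed.

Lemma coroot_in_lattice B b : b \in B -> corootLattice B (coroot b).
Proof.
move=> bB; exists (fun a => (a == b)%:R); rewrite (big_fsetD1 b) //= eqxx.
rewrite big1_seq ?addr0 // => a /andP[_]; rewrite in_fsetD1.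
by case/andP => /negbTE -> _.
Qed.

Lemma sub_corootLattice B C :
    (forall b, b \in B -> corootLattice C (coroot b)) ->
  (corootLattice B `<=` corootLattice C)%classic.
Proof.
move=> BC _ [c ->]; apply: corootLattice_sum => b bB _.
by apply: corootLatticeMz; apply: BC.
Qed.

Lemma dot_corootLattice_int B w v :
    (forall b, b \in B -> dot (coroot b) w \is a Num.int) ->
  corootLattice B v -> dot v w \is a Num.int.
Proof.
move=> Bw [c ->]; rewrite dot_suml big_seq rpred_sum // => b bB.
by rewrite dotMzl rpredMz // Bw.
Qed.

(** If a basis generates the whole coroot lattice, the average over the finite
    quotient has a single term. *)
Lemma latticeQuotient1 (D : rootSystem R n) B :
    corootLattice B = corootLattice (simpleRoots D) ->
  latticeQuotient D B = [fset corootLattice B]%fset.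
Proof.
move=> BQ; rewrite /latticeQuotient -BQ -fset_set1; congr fset_set.
apply/seteqP; split => [_ [q Bq <-]|_ ->] /=.
  apply/seteqP; split => [_ [l Bl <-]|l Bl]; first exact: corootLatticeD.
  by exists (l - q); [exact: corootLatticeB | rewrite addrC subrK].
exists 0; first exact: corootLattice0.
apply/seteqP; split => [_ [l Bl <-]|l Bl]; first by rewrite add0r.
by exists l; rewrite // add0r.
Qed.

End Lattice.

Section RootSystem.
Context {R : realType} {n : nat} (D : rootSystem R n) (I : {set 'I_n}).

Lemma mem_posRootsStar v : (v \in posRootsStar D I) =
  (v \in posRoots D) && (v \notin <<simpleSub D I>>%VS).
Proof. by rewrite !inE; case: (v \in posRoots D); rewrite ?andbT ?andbF. Qed.

Lemma mem_basesI B : (B \in basesI D I) =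
  [&& (B `<=` posRootsStar D I)%fset, #|` B| == #|~: I|
    & basis_of fullv (B `|` simpleSub D I)%fset].
Proof. by rewrite !inE /= fpowersetE. Qed.

End RootSystem.

(** * Functions of period 1 *)

Section Periodicity.
Context {R : realType}.

Lemma fracRDint (x k : R) : k \is a Num.int -> fracR (x + k) = fracR x.
Proof.
move=> kint; rewrite /fracR floorDrz // rmorphD /= (floorK kint).
by rewrite opprD addrACA subrr addr0.
Qed.

Lemma cexp_twopiiDint (x k : R) : k \is a Num.int ->
  cexp (twopii R * (x + k)%:C) = cexp (twopii R * x%:C).
Proof.
have twopiiE u : twopii R * u%:C = 0 +i* (u * (pi *+ 2)).
  apply/eqP; rewrite eq_complex /= mulr_natl.
  by apply/andP; split; apply/eqP; ring.
case/intrP => z ->; rewrite !twopiiE /cexp mulrDl !mulrzl.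
have periodicz (f : R -> R) u (a : int) :
      periodic f u -> forall v : R, f (v + u *~ a) = f v.
  move=> per v; case: a => a; first exact: periodicn.
  by rewrite NegzE mulrNz -[LHS](periodicn per a.+1) subrK.
by rewrite (periodicz _ _ _ (@cosD2pi R)) (periodicz _ _ _ (@sinD2pi R)).
Qed.

End Periodicity.

(** * The roots of Delta^* in type D *)

Section TypeD.
Context {R : realType} {r : nat} (hr : (3 <= r)%N).
Local Notation e := (evec R r).
Local Notation D := (rootSystemD R hr).
Local Notation I := [set i : 'I_r | (2 <= i.+1)%N].
Local Notation i1 := (Ordinal (ltnW (ltnW hr)) : 'I_r).
Implicit Types (b g v y la phi : 'rV[R]_r).

Lemma corootD v : v \in posRootsD R r -> coroot v = v.
Proof. by move=> vD; rewrite coroot_rootsD // in_fsetU vD. Qed.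

Lemma corootsD (B : {fset 'rV[R]_r}) : (B `<=` posRootsD R r)%fset ->
  coroots B = B.
Proof.
move=> /fsubsetP BD; rewrite /coroots -[RHS]map_id; apply/eq_in_map => b bB.
by rewrite corootD ?BD.
Qed.

Lemma dot_simple_e1 i : dot (simpleRoot D i) (e 1) = (i == i1)%:R.
Proof.
rewrite /= /simpleD -val_eqE /=; case: ifPn => [/eqP ir|ir].
  rewrite dotDl !dot_evec; try by lia.
  have [-> -> ->] : [/\ (r.-1 == 1%N) = false, (r == 1%N) = false
    & (i == 0%N :> nat) = false].
    by move: hr; rewrite -[X in (_ < X)%N]ir; split; apply/negP => /eqP; lia.
  by rewrite addr0.
have ir' : (i.+1 < r)%N by rewrite ltn_neqAle ir ltn_ord.
by rewrite dotBl !dot_evec //; [rewrite subr0 | lia].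
Qed.

Lemma i1E (i : 'I_r) : (i \in I) = (i != i1).
Proof. by rewrite inE -val_eqE /= ltnS lt0n. Qed.

(** Pairing with e_1, the first fundamental weight, reads off the coefficient
    of the first simple root. *)
Lemma posRootsD_decomp v : v \in posRootsD R r -> exists c : 'I_r -> nat,
  v = dot v (e 1) *: simpleRoot D i1 + \sum_(i in I) simpleRoot D i *+ c i.
Proof.
move=> vD; have [c vE] := posRootsD_nneg hr vD; exists c.
have -> : dot v (e 1) = (c i1)%:R.
  rewrite vE dot_suml (bigD1 i1) //= big1 => [|i /negbTE ni].
    by rewrite dotMnl dot_simple_e1 eqxx addr0.
  by rewrite dotMnl dot_simple_e1 ni mul0rn.
rewrite scaler_nat {1}vE (bigD1 i1) //=; congr (_ + _).
by apply: eq_bigl => i; rewrite i1E.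
Qed.

Lemma simpleSubP v :
  reflect (exists2 i, i \in I & v = simpleRoot D i) (v \in simpleSub D I).
Proof. exact: imfsetP. Qed.

Lemma simpleRootsP v :
  reflect (exists i, v = simpleRoot D i) (v \in simpleRoots D).
Proof.
by apply: (iffP (imfsetP _ _ _ _)) => [[i _ ->]|[i ->]]; exists i.
Qed.

Lemma simpleSub_span_e1 v : v \in <<simpleSub D I>>%VS -> dot v (e 1) = 0.
Proof.
apply: dot_span0 => _ /simpleSubP[i iI ->].
by rewrite dot_simple_e1; move: iI; rewrite i1E => /negbTE ->.
Qed.

Lemma posRootsD_lattice v :
  v \in posRootsD R r -> corootLattice (simpleRoots D) v.
Proof.
move=> vD; have [c ->] := posRootsD_nneg hr vD.
apply: corootLattice_sum => i _ _; rewrite pmulrn; apply: corootLatticeMz.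
rewrite -[X in corootLattice _ X]corootD; last exact: (simpleD_pos R hr).
by apply: coroot_in_lattice; apply/simpleRootsP; exists i.
Qed.

(** Delta^* as an explicit list, over which sums and products split into the
    two signs. *)
Definition starD : seq 'rV[R]_r :=
  [seq e 1 - e j | j <- index_iota 2 r.+1] ++
  [seq e 1 + e j | j <- index_iota 2 r.+1].

Lemma starDP v : reflect
  (exists2 j, (2 <= j <= r)%N & v = e 1 - e j \/ v = e 1 + e j)
  (v \in starD).
Proof.
rewrite mem_cat; apply: (iffP orP) => [[] /mapP[j]|[j jr [] ->]].
- by rewrite mem_index_iota => jr ->; exists j; [|left].
- by rewrite mem_index_iota => jr ->; exists j; [|right].
- by left; apply/mapP; exists j; rewrite ?mem_index_iota.
- by right; apply/mapP; exists j; rewrite ?mem_index_iota.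
Qed.

Lemma e1_range : (0 < 1 <= r)%N. Proof. by lia. Qed.

Lemma dot_starD_e1 b : b \in starD -> dot b (e 1) = 1.
Proof.
case/starDP => j jr [] ->.
all: rewrite ?dotBl ?dotDl !dot_evec ?e1_range //; try lia.
all: by rewrite (_ : (j == 1%N) = false) ?subr0 ?addr0 //; lia.
Qed.

Lemma starD_pos b : b \in starD -> b \in posRootsD R r.
Proof.
case/starDP => j jr bE; apply/posRootsDP; exists 1%N, j; split => //; lia.
Qed.

(** A positive root lies in the span of Psi_I exactly when it is orthogonal to
    e_1. *)
Lemma mem_posRootsStarD v : (v \in posRootsStar D I) = (v \in starD).
Proof.
rewrite mem_posRootsStar -[posRoots D]/(posRootsD R r).
apply/idP/idP => [/andP[vD vS]|vS]; last first.
  rewrite (starD_pos _ vS) /=; apply/negP => /simpleSub_span_e1.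
  by rewrite dot_starD_e1 // => /eqP; rewrite oner_eq0.
have v1 : dot v (e 1) != 0.
  apply: contraNneq vS => v1; have [c ->] := posRootsD_decomp _ vD.
  rewrite v1 scale0r add0r rpred_sum // => i iI.
  by rewrite rpredMn // memv_span //; apply/simpleSubP; exists i.
have /posRootsDP[i [j [i0 ij jr vE]]] := vD; move: v1.
have [i_eq1|i_neq1] := eqVneq i 1%N.
  by move=> _; rewrite i_eq1 in ij vE; apply/starDP; exists j => //; lia.
case: vE => ->; rewrite ?dotBl ?dotDl !dot_evec ?(negbTE i_neq1); try lia.
all: by rewrite (_ : (j == 1%N) = false) ?subr0 ?addr0 ?eqxx //; lia.
Qed.

Lemma evec_inj i j : (0 < i <= r)%N -> e i = e j -> i = j.
Proof.
move=> ir eij; have := @dot_evec R r i i ir; rewrite {2}eij dot_evec // eqxx.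
by case: eqP => // _ /eqP; rewrite eq_sym oner_eq0.
Qed.

Lemma eqBe1 i j : (2 <= i <= r)%N -> (e 1 - e i == e 1 - e j) = (i == j).
Proof.
move=> ir; rewrite (inj_eq (addrI _)) (inj_eq oppr_inj).
by apply/eqP/eqP => [eij|->//]; apply: evec_inj eij; lia.
Qed.

Lemma eqDe1 i j : (2 <= i <= r)%N -> (e 1 + e i == e 1 + e j) = (i == j).
Proof.
move=> ir; rewrite (inj_eq (addrI _)).
by apply/eqP/eqP => [eij|->//]; apply: evec_inj eij; lia.
Qed.

Lemma neqBDe1 i j : (2 <= i <= r)%N -> (e 1 - e i == e 1 + e j) = false.
Proof.
move=> ir; apply/negP; rewrite (inj_eq (addrI _)) => /eqP/(congr1 (dot (e i))).
rewrite dotNr !dot_evec ?eqxx //; try lia.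
by move=> /eqP; rewrite lt_eqF // (lt_le_trans (ltrN10 _)) ?ler0n.
Qed.

Lemma uniq_starD : uniq starD.
Proof.
rewrite cat_uniq !map_inj_in_uniq ?iota_uniq ?andbT /=.
- apply/hasPn => _ /mapP[j jr ->]; apply/negP => /=; case/mapP => i.
  by rewrite mem_index_iota => ir /eqP; rewrite eq_sym neqBDe1.
- move=> i j; rewrite !mem_index_iota => ir _ /eqP; by rewrite eqDe1 // => /eqP.
- move=> i j; rewrite !mem_index_iota => ir _ /eqP; by rewrite eqBe1 // => /eqP.
Qed.

Lemma perm_starD : perm_eq (posRootsStar D I) starD.
Proof. exact: (uniq_perm (fset_uniq _) uniq_starD mem_posRootsStarD). Qed.

(** * The basis attached to a root of Delta^* *)

Section OneRoot.
Context (b : 'rV[R]_r) (bS : b \in starD).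
Local Notation V := ([fset b] `|` simpleSub D I)%fset.

Lemma V_pos : (V `<=` posRootsD R r)%fset.
Proof.
apply/fsubsetP => v; rewrite in_fsetU in_fset1 => /orP[/eqP ->|].
  exact: starD_pos.
by case/simpleSubP => i _ ->; apply: (simpleD_pos R hr).
Qed.

(** Solve for alpha_1, which occurs in b with coefficient 1. *)
Lemma simple1_decomp : exists c : 'I_r -> nat,
  simpleRoot D i1 = b - \sum_(i in I) simpleRoot D i *+ c i.
Proof.
have [c bE] := posRootsD_decomp _ (starD_pos _ bS); exists c.
by rewrite {1}bE dot_starD_e1 // scale1r addrK.
Qed.

Lemma V_span : <<V>>%VS = fullv.
Proof.
apply/eqP; rewrite eqEsubv subvf /=.
have /andP[/eqP <- _] := simple_basis D; apply/span_subvP => _ /mapP[i _ ->].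
have VI j : j \in I -> simpleRoot D j \in <<V>>%VS.
  move=> jI; apply: memv_span; rewrite in_fsetU; apply/orP; right.
  by apply/simpleSubP; exists j.
have [->|] := eqVneq i i1; last by rewrite -i1E; apply: VI.
have [c ->] := simple1_decomp; rewrite rpredB ?rpred_sum //.
  by rewrite memv_span // in_fsetU in_fset1 eqxx.
by move=> j jI; rewrite rpredMn ?VI.
Qed.

Lemma card_I : #|~: I| = 1%N.
Proof.
rewrite (_ : ~: I = [set i1]) ?cards1 //.
by apply/setP => i; rewrite finset.in_setC i1E negbK inE.
Qed.

Lemma V_basis : basis_of fullv V.
Proof.
rewrite basisEdim V_span subvv /= dimvf /dim /= mul1n.
suff: (#|` V| <= 1 + #|I|)%N.
  by have := cardsC I; rewrite card_I card_ord addnC => ->.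
rewrite cardfsU1 leq_add ?leq_b1 //.
apply: leq_trans (leq_imfset_card _ _ _) _.
by rewrite cardE.
Qed.

(** V consists of positive roots, and conversely simple1_decomp expresses
    alpha_1 over the integers. *)
Lemma lattice_V : corootLattice V = corootLattice (simpleRoots D).
Proof.
apply/seteqP; split; apply: sub_corootLattice => v.
  by move=> /(fsubsetP V_pos) vD; rewrite corootD //; apply: posRootsD_lattice.
have Vlat w : w \in V -> corootLattice V w.
  move=> wV; rewrite -(corootD _ (fsubsetP V_pos _ wV)).
  exact: coroot_in_lattice.
have VI j : j \in I -> corootLattice V (simpleRoot D j).
  move=> jI; apply: Vlat; rewrite in_fsetU; apply/orP; right.
  by apply/simpleSubP; exists j.
case/simpleRootsP => i ->; rewrite corootD; last exact: (simpleD_pos R hr).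
have [->|] := eqVneq i i1; last by rewrite -i1E; apply: VI.
have [c ->] := simple1_decomp; apply: corootLatticeB.
  by apply: Vlat; rewrite in_fsetU in_fset1 eqxx.
apply: corootLattice_sum => j _ jI; rewrite pmulrn.
by apply: corootLatticeMz; apply: VI.
Qed.

(** e_1 is orthogonal to Psi_I and has scalar product 1 with b. *)
Lemma dualVec_V : dualVec V b = e 1.
Proof.
apply: dualVec_unique => [||v vV].
- by rewrite corootsD ?V_basis ?V_pos.
- by rewrite in_fsetU in_fset1 eqxx.
rewrite corootD ?(fsubsetP V_pos) //.
have [->|v_neqb] := eqVneq v b; first exact: dot_starD_e1.
move: vV; rewrite in_fsetU in_fset1 (negbTE v_neqb) /= => vI.
by apply: simpleSub_span_e1; apply: memv_span.
Qed.

Lemma perpProjD la : perpProj D I [fset b]%fset la = la - dot b la *: e 1.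
Proof.
by rewrite /perpProj big_seq_fset1 dualVec_V corootD ?starD_pos.
Qed.

End OneRoot.

(** * The generating function as a sum over Delta^* *)

Lemma basesD : basesI D I = [fset [fset b] | b in posRootsStar D I]%fset.
Proof.
apply/fsetP => B; rewrite mem_basesI card_I.
apply/idP/imfsetP => [/and3P[BS /cardfs1P[b BE] _]|[b /= bS ->]].
  by exists b => //=; move: BS; rewrite BE fsub1set.
rewrite fsub1set bS cardfs1 eqxx /=; apply: V_basis.
by rewrite -mem_posRootsStarD.
Qed.

(** As p(la) = la - <b, la> e_1 and the roots of Delta^* have scalar product 1
    with e_1, the pairings <g, p(la)> become <g - b, la>. *)
Lemma genFunD phi (t : 'rV[R]_r -> R[i]) y la :
    0 < dot phi (e 1) ->
    (forall i, dot (simpleRoot D i) la \is a Num.int) ->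
  genFun D I phi t y la =
  \sum_(b <- starD)
    (\prod_(g <- starD | g != b)
       (t g / (t g - t b - twopii R * (dot (g - b) la)%:C))) *
    (cexp (twopii R * (dot y la - dot b la * dot y (e 1))%:C) *
     (t b * cexp (t b * (fracR (dot y (e 1)))%:C) / (cexp (t b) - 1))).
Proof.
move=> phi1 la_int; rewrite /genFun basesD big_imfset /=; last first.
  by move=> b c _ _; apply: fset1_inj.
rewrite (perm_big _ perm_starD) /=; apply: eq_big_seq => b bS.
have lat_la v : corootLattice (simpleRoots D) v -> dot v la \is a Num.int.
  apply: dot_corootLattice_int => _ /simpleRootsP[i ->].
  by rewrite corootD // (simpleD_pos R hr).
have lat_e1 v : corootLattice (simpleRoots D) v -> dot v (e 1) \is a Num.int.
  apply: dot_corootLattice_int => _ /simpleRootsP[i ->].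
  by rewrite corootD ?dot_simple_e1 ?rpred_nat // (simpleD_pos R hr).
congr (_ * _).
  rewrite -[RHS]big_filter; set s := [seq g <- _ | _].
  have perm_s : perm_eq (posRootsStar D I `\` [fset b])%fset s.
    apply: uniq_perm; rewrite ?fset_uniq ?filter_uniq ?uniq_starD // => g.
    by rewrite in_fsetD in_fset1 mem_filter mem_posRootsStarD.
  rewrite (perm_big _ perm_s); apply: eq_big_seq => g.
  rewrite mem_filter => /andP[_ gS].
  rewrite /linDen big_seq_fset1 dualVec_V // perpProjD // corootD ?starD_pos //.
  by rewrite dotBr dotZr dot_starD_e1 // !mulr1 dotBl.
(* The representative q of the only coset is an unspecified vector of Q^vee. *)
rewrite latticeQuotient1 ?lattice_V // big_seq_fset1 cardfs1 invr1 mul1r.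
set q := xget _ _; have Qq : corootLattice (simpleRoots D) q.
  by apply: xgetPex; exists 0; apply: corootLattice0.
rewrite big_seq_fset1 /fracPart dualVec_V // phi1 perpProjD //.
rewrite (dotDl y q (e 1)) fracRDint ?lat_e1 //; congr (_ * _).
rewrite dotDl !dotBr !dotZr cexp_twopiiDint //.
apply: rpredB; first exact: lat_la.
by apply: rpredM; [apply/lat_la/posRootsD_lattice/starD_pos | exact: lat_e1].
Qed.

(** * Fundamental weights *)

Lemma mem_simpleRoots i : simpleRoot D i \in simpleRoots D.
Proof. by apply/simpleRootsP; exists i. Qed.

Lemma simpleRoots_basis : basis_of fullv (coroots (simpleRoots D)).
Proof.
have simple_uniq : uniq [seq simpleRoot D i | i : 'I_r].
  by apply: free_uniq; case/andP: (simple_basis D).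
rewrite corootsD; last first.
  by apply/fsubsetP => _ /simpleRootsP[i ->]; apply: (simpleD_pos R hr).
rewrite -(perm_basis _ (X := [seq simpleRoot D i | i : 'I_r])).
  exact: simple_basis.
apply: (uniq_perm simple_uniq (fset_uniq _)) => v.
apply/mapP/simpleRootsP => [[i _ ->]|[i ->]]; exists i => //.
by rewrite mem_enum.
Qed.

Lemma simpleRoot_inj : injective (simpleRoot D).
Proof.
apply/injectiveP; rewrite /injectiveb /dinjectiveb.
by apply: free_uniq; case/andP: (simple_basis D).
Qed.

Lemma dot_simple_fundWeight i j :
  dot (simpleRoot D i) (fundWeight D j) = (i == j)%:R.
Proof.
rewrite -[X in dot X _]corootD; last exact: (simpleD_pos R hr).
rewrite /fundWeight dualVecP ?simpleRoots_basis ?mem_simpleRoots //.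
by rewrite (inj_eq simpleRoot_inj).
Qed.

Lemma fundWeight1 : fundWeight D i1 = e 1.
Proof.
apply: dualVec_unique => [||_ /simpleRootsP[i ->]].
- exact: simpleRoots_basis.
- exact: mem_simpleRoots.
rewrite corootD; last exact: (simpleD_pos R hr).
by rewrite dot_simple_e1 (inj_eq simpleRoot_inj).
Qed.

(** * Sums and products over Delta^* as indexed by the formula *)

Lemma prod_nat_neq {T : comNzRingType} (F : nat -> T) j : (2 <= j <= r)%N ->
  \prod_(2 <= i < r.+1 | i != j) F i =
  \prod_(2 <= i < j) F i * \prod_(j.+1 <= i < r.+1) F i.
Proof.
move=> /andP[j2 jr]; rewrite (big_cat_nat _ (n := j)) ?leqW //=; congr (_ * _).
  by rewrite big_nat_cond [RHS]big_nat; apply: eq_bigl => i; lia.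
rewrite big_mkcond big_ltn ?ltnS // eqxx /= mul1r [RHS]big_nat [LHS]big_nat.
by apply: eq_bigr => i ij; rewrite (_ : i != j) //; lia.
Qed.

Lemma prod_star_minus {T : comNzRingType} (F : 'rV[R]_r -> T) j :
    (2 <= j <= r)%N ->
  \prod_(g <- starD | g != e 1 - e j) F g =
  \prod_(2 <= i < j) F (e 1 - e i) * \prod_(j.+1 <= i < r.+1) F (e 1 - e i) *
  \prod_(2 <= i < r.+1) F (e 1 + e i).
Proof.
move=> jr; rewrite big_cat !big_map -prod_nat_neq //=; congr (_ * _).
  rewrite big_nat_cond [RHS]big_nat_cond; apply: eq_bigl => i.
  by case ir: (_ <= _ < _)%N; rewrite //= eqBe1.
rewrite big_nat_cond [RHS]big_nat; apply: eq_bigl => i.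
by case ir: (_ <= _ < _)%N; rewrite //= eq_sym neqBDe1.
Qed.

Lemma prod_star_plus {T : comNzRingType} (F : 'rV[R]_r -> T) j :
    (2 <= j <= r)%N ->
  \prod_(g <- starD | g != e 1 + e j) F g =
  \prod_(2 <= i < r.+1) F (e 1 - e i) *
  (\prod_(2 <= i < j) F (e 1 + e i) * \prod_(j.+1 <= i < r.+1) F (e 1 + e i)).
Proof.
move=> jr; rewrite big_cat !big_map -prod_nat_neq //=; congr (_ * _).
  rewrite big_nat_cond [RHS]big_nat; apply: eq_bigl => i.
  by case ir: (_ <= _ < _)%N; rewrite //= neqBDe1.
rewrite big_nat_cond [RHS]big_nat_cond; apply: eq_bigl => i.
by case ir: (_ <= _ < _)%N; rewrite //= eqDe1.
Qed.

Lemma sum_star {T : nmodType} (F : 'rV[R]_r -> T) :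
  \sum_(b <- starD) F b =
  (\sum_(2 <= j < r) F (e 1 - e j) + F (e 1 - e r)) +
  (\sum_(2 <= j < r) F (e 1 + e j) + F (e 1 + e r)).
Proof.
by rewrite big_cat !big_map; congr (_ + _); rewrite big_nat_recr //; lia.
Qed.

Lemma prod_nat_split {T : comNzRingType} (F : nat -> T) j : (2 <= j < r)%N ->
  \prod_(2 <= i < r.+1) F i =
  \prod_(2 <= i < j.+1) F i * \prod_(j.+1 <= i < r) F i * F r.
Proof.
move=> jr; rewrite big_nat_recr /=; last lia.
by rewrite (big_cat_nat _ (n := j.+1)) //=; lia.
Qed.

(** * The weight lambda in coordinates *)

Section Weight.
Context (m : nat -> int).
Local Notation la := (\sum_(i in I) fundWeight D i *~ m i.+1).
Local Notation a k := (dot (e k) la).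

Lemma dot_simple_la i :
  dot (simpleRoot D i) la = if i \in I then (m i.+1)%:~R else 0.
Proof.
rewrite dot_sumr; case: ifPn => iI; last first.
  rewrite big1 // => j jI; rewrite dotMzr dot_simple_fundWeight.
  by case: eqVneq iI => [->|_ _]; rewrite ?jI // mul0rz.
rewrite (bigD1 i) //= big1 => [|j /andP[_ /negbTE ji]].
  by rewrite dotMzr dot_simple_fundWeight eqxx addr0.
by rewrite dotMzr dot_simple_fundWeight eq_sym ji mul0rz.
Qed.

Lemma coord1_la : a 1%N = a 2%N.
Proof.
have r1 : (1%N == r) = false by lia.
have := dot_simple_la i1; rewrite /= /simpleD /= r1 dotBl inE /=.
by move=> /eqP; rewrite subr_eq0 => /eqP.
Qed.

Lemma coordB_la k : (2 <= k < r)%N -> a k - a k.+1 = (m k)%:~R.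
Proof.
case: k => // k kr; have kr' : (k < r)%N by lia.
have k1 : (k.+1 == r) = false by lia.
have := dot_simple_la (Ordinal kr'); rewrite /= /simpleD /= k1 dotBl inE /=.
by have -> : (1 < k.+1)%N by lia.
Qed.

Lemma coordD_la : a r.-1 + a r = (m r)%:~R.
Proof.
have rr : r.-1.+1 = r by lia.
have kr' : (r.-1 < r)%N by lia.
have := dot_simple_la (Ordinal kr').
rewrite /= /simpleD /= rr eqxx dotDl inE /=.
by rewrite rr; have -> : (1 < r)%N by lia.
Qed.

Lemma sum_coord_la i j : (2 <= i <= j)%N -> (j <= r)%N ->
  \sum_(i <= k < j) (m k)%:~R = a i - a j.
Proof.
move=> /andP[i2 ij] jr; rewrite -[RHS]opprB
  -(telescope_sumr (fun k => a k)) // -sumrN.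
by apply: eq_big_nat => k ikj; rewrite opprB coordB_la //; lia.
Qed.

Lemma dot_yv_la (y : nat -> R) :
  dot (\sum_(i < r) y i.+1 *: coroot (simpleRoot D i)) la
  = \sum_(2 <= k < r.+1) (m k)%:~R * y k.
Proof.
rewrite dot_suml; under eq_bigr => i _.
  rewrite dotZl corootD; last exact: (simpleD_pos R hr).
  rewrite dot_simple_la inE; over.
rewrite -(big_mkord xpredT
  (fun i => y i.+1 * if (1 < i.+1)%N then (m i.+1)%:~R else 0)).
rewrite big_ltn; last by lia.
rewrite /= mulr0 add0r !big_add1.
by apply: eq_bigr => k _; rewrite mulrC.
Qed.

Lemma dot_yv_e1 (y : nat -> R) :
  dot (\sum_(i < r) y i.+1 *: coroot (simpleRoot D i)) (e 1) = y 1%N.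
Proof.
rewrite dot_suml (bigD1 i1) //= big1 => [|i /negbTE ni1].
  rewrite dotZl corootD; last exact: (simpleD_pos R hr).
  by rewrite dot_simple_e1 eqxx mulr1 addr0.
rewrite dotZl corootD; last exact: (simpleD_pos R hr).
by rewrite dot_simple_e1 ni1 mulr0.
Qed.

Lemma sum_weight_shift (y : nat -> R) c i j : (2 <= i <= j)%N -> (j <= r)%N ->
  \sum_(i <= k < j) (m k)%:~R * (y k - c)
  = \sum_(i <= k < j) (m k)%:~R * y k - (a i - a j) * c.
Proof.
move=> ij jr; rewrite -sum_coord_la // mulr_suml -sumrB.
by apply: eq_bigr => k _; rewrite mulrBr.
Qed.

End Weight.
End TypeD.

(** * The explicit formula *)

Theorem mainTheorem2 (R : realType) (r : nat) (hr : (3 <= r)%N)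
    (phi : 'rV[R]_r) (t : 'rV[R]_r -> R[i]) (y : nat -> R) (m : nat -> int) :
  let D := rootSystemD R hr in
  let I : {set 'I_r} := [set i : 'I_r | (2 <= i.+1)%N] in
  let i1 : 'I_r := Ordinal (ltnW (ltnW hr)) in
  let yv : 'rV[R]_r := \sum_(i < r) y i.+1 *: coroot (simpleRoot D i) in
  let la : 'rV[R]_r := \sum_(i in I) fundWeight D i *~ m i.+1 in
  let tm (i : nat) : R[i] := t (evec R r 1 - evec R r i) in
  let tp (i : nat) : R[i] := t (evec R r 1 + evec R r i) in
  let m_ (j k : nat) : R[i] := (\sum_(j <= i < k.+1) m i)%:~R in
  let mR (i : nat) : R := (m i)%:~R in
  let mC (i : nat) : R[i] := (m i)%:~R in
  let ex (x : R) : R[i] := cexp (twopii R * x%:C) in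
  let todd (s : R[i]) : R[i] := s * cexp (s * (fracR (y 1%N))%:C) / (cexp s - 1) in
  genericVec D phi ->
  0 < dot phi (fundWeight D i1) ->
  offPoles D I t la ->
  genFun D I phi t yv la =
    \sum_(2 <= j < r)
      ( (\prod_(2 <= i < j) (tm i / (tm i - tm j + twopii R * m_ i j.-1)))
      * (\prod_(j.+1 <= i < r.+1) (tm i / (tm i - tm j - twopii R * m_ j i.-1)))
      * (\prod_(2 <= i < j.+1)
           (tp i / (tp i - tm j
              - twopii R * (m_ i j.-1 + 2 * m_ j (r - 2)%N + m_ (r - 1)%N r))))
      * (\prod_(j.+1 <= i < r)
           (tp i / (tp i - tm j
              - twopii R * (m_ j i.-1 + 2 * m_ i (r - 2)%N + m_ (r - 1)%N r))))
      * (tp r / (tp r - tm j - twopii R * (m_ j (r - 2)%N + mC r)))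
      * ex (\sum_(2 <= i < j) mR i * (y i - y 1%N)
            + \sum_(j <= i < r.+1) mR i * y i)
      * todd (tm j))
  + (\prod_(2 <= i < r) (tm i / (tm i - tm r + twopii R * m_ i (r - 1)%N)))
      * (\prod_(2 <= i < r)
           (tp i / (tp i - tm r - twopii R * (m_ i (r - 2)%N + mC r))))
      * (tp r / (tp r - tm r - twopii R * (mC r - mC (r - 1)%N)))
      * ex (\sum_(2 <= i < r) mR i * (y i - y 1%N) + mR r * y r)
      * todd (tm r)
  + \sum_(2 <= j < r)
      ( (\prod_(2 <= i < j.+1)
           (tm i / (tm i - tp j
              + twopii R * (m_ i j.-1 + 2 * m_ j (r - 2)%N + m_ (r - 1)%N r))))
      * (\prod_(j.+1 <= i < r)
           (tm i / (tm i - tp j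
              + twopii R * (m_ j i.-1 + 2 * m_ i (r - 2)%N + m_ (r - 1)%N r))))
      * (tm r / (tm r - tp j + twopii R * (m_ j (r - 2)%N + mC r)))
      * (\prod_(2 <= i < j) (tp i / (tp i - tp j - twopii R * m_ i j.-1)))
      * (\prod_(j.+1 <= i < r.+1) (tp i / (tp i - tp j + twopii R * m_ j i.-1)))
      * ex (\sum_(2 <= i < j) mR i * (y i - y 1%N)
            + \sum_(j <= i < (r - 1)%N) mR i * (y i - 2 * y 1%N)
            + mR (r - 1)%N * (y (r - 1)%N - y 1%N)
            + mR r * (y r - y 1%N))
      * todd (tp j))
  + (\prod_(2 <= i < r)
       (tm i / (tm i - tp r + twopii R * (m_ i (r - 2)%N + mC r))))
      * (tm r / (tm r - tp r - twopii R * (mC (r - 1)%N - mC r)))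
      * (\prod_(2 <= i < r) (tp i / (tp i - tp r - twopii R * m_ i (r - 1)%N)))
      * ex (\sum_(2 <= i < (r - 1)%N) mR i * (y i - y 1%N)
            + mR (r - 1)%N * y (r - 1)%N + mR r * (y r - y 1%N))
      * todd (tp r).
Proof.
move=> D I i1 yv la tm tp m_ mR mC ex todd _ phi1 _.
pose e k := evec R r k.
pose a k : R := dot (e k) la; pose c k : R[i] := (a k)%:C.
have r1 : (r - 1)%N = r.-1 by lia.
have mB i j : (2 <= i <= j)%N -> (j <= r)%N -> m_ i j.-1 = c i - c j.
  move=> ij jr; rewrite /m_ prednK; last lia.
  by rewrite -rmorphB -sum_coord_la // -rmorph_sum rmorph_int.
have a_r : (m r)%:~R = a r.-1 + a r by rewrite [RHS](coordD_la hr m).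
have a_r1 : (m r.-1)%:~R = a r.-1 - a r.
  by rewrite -[in a r](@prednK r) ?[RHS](coordB_la hr m) //; lia.
have m_r : mC r = c r.-1 + c r by rewrite -rmorphD -a_r rmorph_int.
have m_r1 : mC r.-1 = c r.-1 - c r by rewrite -rmorphB -a_r1 rmorph_int.
have m_jr j : (2 <= j < r)%N -> m_ j (r - 2)%N = c j - c r.-1.
  by move=> jr; rewrite (_ : (r - 2)%N = r.-1.-1) ?mB //; lia.
have m_pair : m_ r.-1 r = 2 * c r.-1.
  have r0 : (0 < r)%N by lia.
  have -> : m_ r.-1 r = mC r.-1 + mC r.
    rewrite /m_ big_nat_recr /= ?leq_pred // -{2}(prednK r0).
    by rewrite big_nat1 rmorphD.
  rewrite m_r m_r1.
  ring.
have phi_e1 : 0 < dot phi (e 1%N) by rewrite /e -(fundWeight1 hr).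
have la_int i : dot (simpleRoot D i) la \is a Num.int.
  by rewrite dot_simple_la; case: ifP => _; rewrite ?rpred0 ?intr_int.
have a1 : a 1%N = a 2%N by apply: coord1_la.
(* The constants <g - b, lambda> in the denominators; the letters B and D give
   the signs of e_i in g and of e_j in b. *)
have dBB i j : (dot (e 1%N - e i - (e 1%N - e j)) la)%:C =
    c j - c i.
  rewrite -rmorphB !dotBl.
  by congr (_%:C); rewrite -!/(a _); ring.
have dDB i j : (dot (e 1%N + e i - (e 1%N - e j)) la)%:C =
    c i + c j.
  rewrite -rmorphD !(dotBl, dotDl).
  by congr (_%:C); rewrite -!/(a _); ring.
have dBD i j : (dot (e 1%N - e i - (e 1%N + e j)) la)%:C =
    - (c i + c j).
  rewrite -rmorphD -rmorphN !(dotBl, dotDl).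
  by congr (_%:C); rewrite -!/(a _); ring.
have dDD i j : (dot (e 1%N + e i - (e 1%N + e j)) la)%:C =
    c i - c j.
  rewrite -rmorphB !(dotBl, dotDl).
  by congr (_%:C); rewrite -!/(a _); ring.
pose yla : R := \sum_(2 <= k < r.+1) (m k)%:~R * y k.
have ex_shift b (s : R) : s = yla - dot b la * y 1%N ->
    cexp (twopii R * (yla - dot b la * y 1%N)%:C) = ex s.
  by move=> ->.
have sum_shift x i j : (2 <= i <= j)%N -> (j <= r)%N ->
    \sum_(i <= k < j) (m k)%:~R * (y k - x) =
    \sum_(i <= k < j) (m k)%:~R * y k - (a i - a j) * x.
  exact: sum_weight_shift.
have sum_last2 j : (j <= r.-1)%N ->
    \sum_(j <= k < r.+1) (m k)%:~R * y k =
    \sum_(j <= k < r.-1) (m k)%:~R * y k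
      + (m r.-1)%:~R * y r.-1 + (m r)%:~R * y r.
  move=> jr; rewrite big_nat_recr /=; last lia.
  by rewrite -[in X in \sum_(_ <= k < X) _](@prednK r) ?big_nat_recr //; lia.
rewrite (genFunD hr _ _ _ _ phi_e1 la_int) dot_yv_e1 dot_yv_la (sum_star hr).
rewrite r1 -[RHS]addrA.
congr (_ + _ + (_ + _)).
(* In order: b = e_1 - e_j with j < r, b = e_1 - e_r, b = e_1 + e_j with j < r,
   and b = e_1 + e_r. *)
- apply: eq_big_nat => j jr.
  have reassoc (A B C E F X T : R[i]) :
    A * B * (C * E * F) * (X * T) = A * B * C * E * F * X * T by ring.
  rewrite prod_star_minus; last lia.
  rewrite (prod_nat_split hr _ _ jr) reassoc.
  congr (_ * _ * _ * _ * _ * _ * _).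
  + apply: eq_big_nat => i ij; rewrite dBB mB; try lia.
    rewrite -/(tm i) -/(tm j); congr (_ / _); ring.
  + apply: eq_big_nat => i ij; rewrite dBB mB; try lia.
    rewrite -/(tm i) -/(tm j); congr (_ / _); ring.
  + apply: eq_big_nat => i ij; rewrite dDB mB ?m_jr ?m_pair; try lia.
    rewrite -/(tp i) -/(tm j); congr (_ / _); ring.
  + apply: eq_big_nat => i ij; rewrite dDB mB ?m_jr ?m_pair; try lia.
    rewrite -/(tp i) -/(tm j); congr (_ / _); ring.
  + rewrite dDB m_jr ?m_r; try lia.
    rewrite -/(tp r) -/(tm j); congr (_ / _); ring.
  + apply: ex_shift; rewrite /mR /yla sum_shift ?dotBl -!/(a _) ?a1; try lia.
    rewrite [in RHS](big_cat_nat _ (n := j)); try lia.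
    rewrite /=; ring.
  + by [].
- have reassoc (A C F X T : R[i]) :
    A * 1 * (C * F) * (X * T) = A * C * F * X * T by ring.
  rewrite prod_star_minus; last lia.
  rewrite (@big_geq _ _ _ r.+1 r.+1) // (@big_nat_recr _ _ _ r) /=; last lia.
  rewrite reassoc.
  congr (_ * _ * _ * _ * _).
  + apply: eq_big_nat => i ij; rewrite dBB mB; try lia.
    rewrite -/(tm i) -/(tm r); congr (_ / _); ring.
  + apply: eq_big_nat => i ij; rewrite dDB m_jr ?m_r; try lia.
    rewrite -/(tp i) -/(tm r); congr (_ / _); ring.
  + rewrite dDB m_r m_r1 -/(tp r) -/(tm r); congr (_ / _); ring.
  + apply: ex_shift; rewrite /mR /yla sum_shift ?dotBl -!/(a _) ?a1; try lia.
    rewrite [in RHS]big_nat_recr /=; last lia.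
    ring.
  + by [].
- apply: eq_big_nat => j jr.
  have reassoc (A B C E F X T : R[i]) :
    A * B * F * (C * E) * (X * T) = A * B * F * C * E * X * T by ring.
  rewrite prod_star_plus; last lia.
  rewrite (prod_nat_split hr _ _ jr) reassoc.
  congr (_ * _ * _ * _ * _ * _ * _).
  + apply: eq_big_nat => i ij; rewrite dBD mB ?m_jr ?m_pair; try lia.
    rewrite -/(tm i) -/(tp j); congr (_ / _); ring.
  + apply: eq_big_nat => i ij; rewrite dBD mB ?m_jr ?m_pair; try lia.
    rewrite -/(tm i) -/(tp j); congr (_ / _); ring.
  + rewrite dBD m_jr ?m_r; try lia.
    rewrite -/(tm r) -/(tp j); congr (_ / _); ring.
  + apply: eq_big_nat => i ij; rewrite dDD mB; try lia.
    rewrite -/(tp i) -/(tp j); congr (_ / _); ring.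
  + apply: eq_big_nat => i ij; rewrite dDD mB; try lia.
    rewrite -/(tp i) -/(tp j); congr (_ / _); ring.
  + apply: ex_shift; rewrite /mR /yla !sum_shift ?dotDl -!/(a _) ?a1; try lia.
    rewrite [in RHS](big_cat_nat _ (n := j)); try lia.
    rewrite [X in _ = _ + X - _](sum_last2 j) /= ?a_r ?a_r1; last lia.
    ring.
  + by [].
- have reassoc (A C F X T : R[i]) :
    A * F * (C * 1) * (X * T) = A * F * C * X * T by ring.
  rewrite prod_star_plus; last lia.
  rewrite (@big_geq _ _ _ r.+1 r.+1) // (@big_nat_recr _ _ _ r) /=; last lia.
  rewrite reassoc.
  congr (_ * _ * _ * _ * _).
  + apply: eq_big_nat => i ij; rewrite dBD m_jr ?m_r; try lia.
    rewrite -/(tm i) -/(tp r); congr (_ / _); ring.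
  + rewrite dBD m_r m_r1 -/(tm r) -/(tp r); congr (_ / _); ring.
  + apply: eq_big_nat => i ij; rewrite dDD mB; try lia.
    rewrite -/(tp i) -/(tp r); congr (_ / _); ring.
  + apply: ex_shift; rewrite /mR /yla sum_shift ?dotDl -!/(a _) ?a1; try lia.
    rewrite [X in _ = X - _](sum_last2 2) ?a_r ?a_r1; last lia.
    ring.
  + by [].
Qed.
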